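(* Let $A:X\to Y$ be a nonzero bounded linear operator between real Hilbert spaces, $y\in Y$, $f(x)=\frac12\|Ax-y\|^2$. Let $\lambda\in]0,2\|A^*A\|^{-1}[$, $x_0\in X$, and let $(x_n)$ be generated by the Landweber algorithm $x_{n+1}=x_n-\lambda A^*(Ax_n-y)$, $n\in\mathbb{N}$. Assume that for some $\mu\in]-1/2,+\infty[$ the source condition $x_0\in X_\mu$ is satisfied. Then: (i) $f(x_n)-\inf f=O(n^{-(1+2\mu)})$; (ii) if $\mu>0$, then $\|x_n-\bar x_0\|=O(n^{-\mu})$, where $\bar x_0$ is the orthogonal projection of $x_0$ onto $\operatorname{argmin} f$.
   Context: Let $y^\dagger$ be the orthogonal projection of $y$ onto $\operatorname{cl} R(A)$, where $R(\cdot)$ denotes the range. For $\nu>0$, $Y_\nu:=y^\dagger+R((AA^* )^\nu)$, with $(AA^* )^\nu$ defined by the functional calculus. For $\mu>-1/2$, the regularity space is the preimage $X_\mu:=A^{-1}Y_{\mu+1/2}$. (If $\mu\ge0$, $X_\mu\ne\emptyset$ implies $\operatorname{argmin} f\neq\emptyset$.) *)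

(* Defs.v *)
From HB Require Import structures.
From mathcomp Require Import all_boot all_order all_algebra.
From mathcomp Require Import all_classical all_reals all_analysis.

Set Implicit Arguments.
Unset Strict Implicit.
Unset Printing Implicit Defensive.

Import Order.TTheory GRing.Theory Num.Theory.
Import numFieldTopology.Exports numFieldNormedType.Exports.

Local Open Scope classical_set_scope.
Local Open Scope ring_scope.

HB.mixin Record isHilbert (R : realType) X of CompleteNormedModule R X := {
  inner : {dot X for (idfun : R -> R)} ;
  inner_norm : forall x : X, inner x x = `|x| ^+ 2
}.

#[short(type="hilbertType")]
HB.structure Definition Hilbert (R : realType) :=
  {X of CompleteNormedModule R X & isHilbert R X}.

Definition bounded_op (R : realType) (U V : normedModType R) (T : U -> V) :=
  exists M : R, forall x, `|T x| <= M * `|x|.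

(* Only meaningful for bounded operators: [sup] of an unbounded set is 0. *)
Definition opnorm (R : realType) (U V : normedModType R) (T : U -> V) : R :=
  sup [set `|T x| | x in [set x | `|x| <= 1]].

Definition adjoint (R : realType) (X Y : hilbertType R) (T : X -> Y) : Y -> X :=
  fun y => xget 0 [set z | forall x, inner (T x) y = inner x z].

(* Nearest point of [C]; unique, and existing as soon as [C] is a nonempty
   closed convex set, in particular a closed affine subspace. *)
Definition orth_proj (R : realType) (X : hilbertType R) (C : set X) (x : X) : X :=
  xget 0 [set p | C p /\ forall c, C c -> `|x - p| <= `|x - c|].

Definition argmin (R : realType) (T : Type) (f : T -> R) : set T :=
  [set x | forall z, f x <= f z].

Definition poly_op (R : realType) (X : normedModType R) (p : {poly R})
    (T : X -> X) : X -> X :=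
  fun x => \sum_(i < size p) p`_i *: iter i T x.

(* Real spectrum, which is the whole spectrum when [T] is self-adjoint. *)
Definition spectrum (R : realType) (X : normedModType R) (T : X -> X) : set R :=
  [set t | ~ exists S : X -> X,
    [/\ linear S, bounded_op S, cancel (fun x => T x - t *: x) S
      & cancel S (fun x => T x - t *: x)]].

(* Continuous functional calculus [phi(T)] of a bounded self-adjoint operator:
   the operator-norm limit of [p_k(T)], for any polynomials [p_k] converging to
   [phi] uniformly on the spectrum of [T]. *)
Definition fun_calc (R : realType) (X : normedModType R) (phi : R -> R)
    (T : X -> X) : X -> X :=
  xget (fun=> 0) [set S | [/\ linear S, bounded_op S
    & exists p : nat -> {poly R},
        {uniform spectrum T, (fun k t => (p k).[t]) @ \oo --> phi} /\
        opnorm (fun x => poly_op (p k) T x - S x) @[k --> \oo] --> (0 : R)]].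

Definition op_powR (R : realType) (X : normedModType R) (T : X -> X) (nu : R) :
    X -> X :=
  fun_calc (fun t => t `^ nu) T.

Section regularity.
Variables (R : realType) (X Y : hilbertType R) (A : X -> Y) (y : Y).

Definition ydagger : Y := orth_proj (closure (range A)) y.

Definition Yspace (nu : R) : set Y :=
  [set ydagger + w | w in range (op_powR (A \o adjoint A) nu)].

Definition Xspace (mu : R) : set X := A @^-1` Yspace (mu + 2^-1).

Definition least_squares (x : X) : R := 2^-1 * `|A x - y| ^+ 2.

End regularity.

(* Main.v *)
Require Import Defs.
From HB Require Import structures.
From mathcomp Require Import all_boot all_order all_algebra.
From mathcomp Require Import all_classical all_reals all_analysis.
From mathcomp Require Import ring lra.
From mathcomp Require complex.
Set Implicit Arguments.
Unset Strict Implicit.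
Unset Printing Implicit Defensive.

Import Order.TTheory GRing.Theory Num.Theory.
Import numFieldTopology.Exports numFieldNormedType.Exports.
Local Open Scope classical_set_scope.
Local Open Scope ring_scope.

(** Write [A*] for the adjoint of [A], [B = A A*], [yd] for the projection of
    [y] onto the closure of the range of [A], [nu = mu + 1/2], and [S = B^nu].
    The source condition says that the initial residual [A x0 - yd] is [S w]
    for some [w].  Since [A* y = A* yd], the Landweber step multiplies the
    residual by [1 - lambda B], so that

      [A x_n - yd = (1 - lambda B)^n S w].

    By Pythagoras the gap [f(x_n) - inf f] is at most half the square of this
    norm.  On the spectrum of [B], which lies in [[0, L]] with
    [L = ||A* A|| < 2 / lambda], the function [(1 - lambda t)^n t^nu] is
    [O(n^-nu)] ([landweber_filter_le]), which gives (i) once a supremum over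
    the spectrum is known to bound a norm.

    For (ii), the increments are [x_m - x_(m+k) = A* g(B) S w] with
    [t g(t) = (1 - lambda t)^m - (1 - lambda t)^(m+k)].  The squared norm of
    an increment is [<B g(B)^2 S w, S w>], hence is controlled by the supremum
    of [t g(t)^2 t^(2 nu) = (t g(t) t^mu)^2], which is [O(m^(-2 mu))].  So the
    iterates form a Cauchy sequence with an explicit rate.  Its limit [l]
    satisfies [A l = yd] because the residuals vanish, and [x0 - l] is
    orthogonal to the kernel of [A] because all increments lie in the range
    of [A*]; therefore [l] is the projection of [x0] onto the minimizers.
    This route produces a minimizer and its distance to [x_n] together,
    without any factorization of [B^nu] through [A].

    The passage from the spectrum to norms is [inner_fun_calc_le].  The
    operator [S] is a norm limit of polynomials [p_k(B)], where [p_k] converges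
    to [t^nu] uniformly on the spectrum, so it suffices to bound [||p(B)||] by
    the supremum of [|p|] ([poly_op_le]).  It is enough, and easier, to work on
    the approximate point spectrum, the set of [t] such that [B - t] is not
    bounded below: a polynomial without roots there is bounded below at [B],
    factor by factor ([bounded_below_poly_op]), whereas [s^2 - p(B)^2] is not
    bounded below when [s] is the norm of [p(B)]. *)

(** * Inner products *)

Section InnerProduct.
Variables (R : realType) (X : hilbertType R).
Implicit Types u v w : X.

Lemma innerC u v : inner u v = inner v u.
Proof. by rewrite hermC expr0 mul1r. Qed.

Lemma innerDl u v w : inner (u + v) w = inner u w + inner v w.
Proof. exact: linearDl. Qed.

Lemma innerZl (a : R) u w : inner (a *: u) w = a * inner u w.
Proof. exact: linearZl_LR. Qed.

Lemma innerNl u w : inner (- u) w = - inner u w.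
Proof. exact: linearNl. Qed.

Lemma innerBl u v w : inner (u - v) w = inner u w - inner v w.
Proof. by rewrite innerDl innerNl. Qed.

Lemma inner0l w : inner 0 w = 0.
Proof. exact: linear0l. Qed.

Lemma innerDr u v w : inner w (u + v) = inner w u + inner w v.
Proof. by rewrite innerC innerDl !(innerC w). Qed.

Lemma innerZr (a : R) u w : inner w (a *: u) = a * inner w u.
Proof. by rewrite innerC innerZl innerC. Qed.

Lemma innerNr u w : inner w (- u) = - inner w u.
Proof. by rewrite innerC innerNl innerC. Qed.

Lemma innerBr u v w : inner w (u - v) = inner w u - inner w v.
Proof. by rewrite innerDr innerNr. Qed.

Lemma inner0r w : inner w 0 = 0.
Proof. by rewrite innerC inner0l. Qed.

Lemma sqr_normD u v : `|u + v| ^+ 2 = `|u| ^+ 2 + 2 * inner u v + `|v| ^+ 2.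
Proof.
by rewrite -!inner_norm innerDl !innerDr (innerC v u); ring.
Qed.

Lemma sqr_normB u v : `|u - v| ^+ 2 = `|u| ^+ 2 - 2 * inner u v + `|v| ^+ 2.
Proof. by rewrite sqr_normD normrN innerNr mulrN. Qed.

(** This is the nonnegativity of the squared norm of [|v|^2 u - <u, v> v]. *)
Lemma Cauchy_Schwarz u v : `|inner u v| <= `|u| * `|v|.
Proof.
have [->|v0] := eqVneq v 0; first by rewrite inner0r !normr0 mulr0.
have vp : 0 < `|v| by rewrite normr_gt0.
have := sqr_ge0 (`| `|v| ^+ 2 *: u - inner u v *: v |).
rewrite sqr_normB !normrZ innerZl innerZr !exprMn !real_normK ?num_real//.
set i := inner u v => h.
rewrite -ler_sqr ?nnegrE ?mulr_ge0// real_normK ?num_real// exprMn.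
have v2 : 0 < `|v| ^+ 2 by rewrite exprn_gt0.
suff : 0 <= `|v| ^+ 2 * (`|u| ^+ 2 * `|v| ^+ 2 - i ^+ 2).
  by rewrite pmulr_rge0// subr_ge0.
by apply: le_trans h _; rewrite le_eqVlt; apply/orP; left; apply/eqP; ring.
Qed.

Lemma inner_le u v : inner u v <= `|u| * `|v|.
Proof. exact: le_trans (ler_norm _) (Cauchy_Schwarz u v). Qed.

Lemma parallelogram u v :
  `|u + v| ^+ 2 + `|u - v| ^+ 2 = 2 * `|u| ^+ 2 + 2 * `|v| ^+ 2.
Proof. by rewrite sqr_normD sqr_normB; ring. Qed.

Lemma inner_eq_all u v : (forall w, inner w u = inner w v) -> u = v.
Proof.
move=> h; apply/eqP; rewrite -subr_eq0 -normr_eq0 -sqrf_eq0 -inner_norm.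
by rewrite innerBr !h subrr.
Qed.

End InnerProduct.

(** By polarization, continuity of the inner product reduces to that of the
    norm. *)
Lemma cvg_inner (R : realType) (X : hilbertType R) (u v : nat -> X) (a b : X) :
  u @ \oo --> a -> v @ \oo --> b ->
  (fun n => inner (u n) (v n)) @ \oo --> inner a b.
Proof.
have pol (c d : X) : inner c d = 4^-1 * (`|c + d| * `|c + d| - `|c - d| * `|c - d|).
  by rewrite -!expr2 sqr_normB sqr_normD; field.
move=> ua vb; rewrite pol; under eq_fun do rewrite pol.
have hD : (fun n => `|u n + v n|) @ \oo --> `|a + b|.
  exact: cvg_norm (cvgD ua vb).
have hB : (fun n => `|u n - v n|) @ \oo --> `|a - b|.
  exact: cvg_norm (cvgB ua vb).
apply: cvgM; first exact: cvg_cst.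
by apply: cvgB; [exact: (cvgM hD hD)|exact: (cvgM hB hB)].
Qed.

(** * Bounded linear maps and convergence *)

(** Lets the canonical structures see a map, such as [adjoint A] or a value of
    [fun_calc], whose linearity is only a proposition. *)
Lemma linear_ex (R : realType) (U V : lmodType R) (f : U -> V) : linear f ->
  exists g : {linear U -> V}, f = g.
Proof.
move=> fL; pose g : {linear U -> V} :=
  HB.pack f (GRing.isLinear.Build R U V *:%R f fL).
by exists g.
Qed.

Section BoundedOperator.
Variables (R : realType) (U V : normedModType R).

Lemma bounded_op_ge0 (T : U -> V) : bounded_op T ->
  exists2 M : R, 0 <= M & forall x, `|T x| <= M * `|x|.
Proof.
move=> [M hM]; exists `|M| => // x; apply: le_trans (hM x) _.
by rewrite ler_wpM2r// ler_norm.
Qed.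

Lemma bounded_op_continuous (T : {linear U -> V}) :
  bounded_op T -> continuous T.
Proof.
move=> /bounded_op_ge0[M M0 hM] x; apply/cvgrPdist_le => e e0.
have M1 : 0 < M + 1 by rewrite ltr_pwDr.
near=> z; rewrite -linearB; apply: le_trans (hM _) _.
have : `|x - z| <= e / (M + 1).
  by near: z; apply: cvgr_dist_le; rewrite ?divr_gt0//; exact: cvg_id.
rewrite ler_pdivlMr// => h; apply: le_trans h.
by rewrite mulrC ler_wpM2l// lerDl.
Unshelve. all: by end_near. Qed.

Lemma bounded_op_cvg (T : {linear U -> V})
  (u : nat -> U) (l : U) : bounded_op T ->
  u @ \oo --> l -> (fun n => T (u n)) @ \oo --> T l.
Proof.
by move=> Tb ul; apply: (cvg_comp _ _ ul); exact: bounded_op_continuous.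
Qed.

End BoundedOperator.

Section OpNorm.
Variables (R : realType) (U V : normedModType R) (T : {linear U -> V}).
Hypothesis T_bounded : bounded_op T.

Let has_sup_opnorm : has_sup [set `|T x| | x in [set x | `|x| <= 1]].
Proof.
split; first by exists `|T 0|; exists 0 => //=; rewrite normr0.
have [M M0 hM] := bounded_op_ge0 T_bounded.
exists M => _ [x /= x1 <-]; apply: le_trans (hM x) _.
by rewrite ler_piMr.
Qed.

Lemma opnorm_ge0 : 0 <= opnorm T.
Proof.
apply: le_trans (normr_ge0 (T 0)) _.
by apply: ub_le_sup; [exact: has_sup_opnorm.2 | exists 0 => //=; rewrite normr0].
Qed.

Lemma opnormP x : `|T x| <= opnorm T * `|x|.
Proof.
have [->|x0] := eqVneq x 0; first by rewrite linear0 !normr0 mulr0.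
have xp : 0 < `|x| by rewrite normr_gt0.
rewrite -ler_pdivrMr//.
have -> : `|T x| / `|x| = `|T (`|x|^-1 *: x)|.
  by rewrite linearZ normrZ ger0_norm ?invr_ge0// mulrC.
apply: ub_le_sup; first exact: has_sup_opnorm.2.
exists (`|x|^-1 *: x) => //=.
by rewrite normrZ ger0_norm ?invr_ge0// mulVf// gt_eqF.
Qed.

Lemma opnorm_le (c : R) : 0 <= c -> (forall x, `|T x| <= c * `|x|) ->
  opnorm T <= c.
Proof.
move=> c0 hc; apply: ge_sup; first exact: has_sup_opnorm.1.
move=> _ [x /= x1 <-]; apply: le_trans (hc x) _.
by rewrite ler_piMr.
Qed.

End OpNorm.

Section Convergence.
Variables (R : realType) (V : normedModType R).

Lemma cvg_norm_bound (u : nat -> V) (l : V) (e : nat -> R) :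
  (forall n, `|l - u n| <= e n) -> e @ \oo --> (0 : R) -> u @ \oo --> l.
Proof.
move=> ule e0; apply/cvgrPdist_le => eps eps0.
move/cvgrPdist_le : e0 => /(_ eps eps0); apply: filterS => n.
rewrite sub0r normrN => en.
exact: le_trans (ule n) (le_trans (ler_norm _) en).
Qed.

End Convergence.

(** The rate that makes the sequence Cauchy is inherited by the limit.  It
    yields both nearest points and the rate of the Landweber iterates. *)
Lemma cauchy_rate_cvg (R : realType) (X : completeNormedModType R)
  (u : nat -> X) (e : nat -> R) :
  (forall m n, (m <= n)%N -> `|u n - u m| <= e m) -> e @ \oo --> (0 : R) ->
  exists l, forall m, `|l - u m| <= e m.
Proof.
move=> ue e0.
have uc : cvg (u @ \oo).
  apply: cauchy_cvg; apply: cauchy_exP => _/posnumP[eps].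
  move/cvgrPdist_lt : e0 => /(_ eps%:num ltac:(by [])) [N _ hN].
  exists (u N); exists N => // n /= Nn; rewrite -ball_normE/= distrC.
  apply: le_lt_trans (ue _ _ Nn) _.
  have := hN N (leqnn N); rewrite /= sub0r normrN.
  exact: le_lt_trans (ler_norm _).
exists (lim (u @ \oo)) => m.
have h : (fun n => `|u n - u m|) @ \oo --> `|lim (u @ \oo) - u m|.
  by apply: cvg_norm; apply: cvgB => //; exact: cvg_cst.
apply: (ler_cvg_to h (cvg_cst (e m))).
by exists m => // n /= mn; exact: ue.
Qed.

(** * Orthogonal projections and adjoints *)

Section Projection.
Variables (R : realType) (X : hilbertType R).
Implicit Types (C V : set X) (x p v : X).

(** The parallelogram identity makes every minimizing sequence Cauchy, because
    midpoints stay in [C] and so cannot be closer to [x] than the infimum. *)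
Lemma nearest_point_exists C x : C !=set0 -> closed C ->
  (forall c d, C c -> C d -> C (2^-1 *: (c + d))) ->
  exists p, C p /\ forall c, C c -> `|x - p| <= `|x - c|.
Proof.
move=> [c0 Cc0] clC midC.
pose D := [set `|x - c| ^+ 2 | c in C].
have D0 : D !=set0 by exists (`|x - c0| ^+ 2); exists c0.
have lbD : lbound D 0 by move=> _ [c _ <-]; exact: sqr_ge0.
have hiD : has_inf D by split => //; exists 0.
pose d := inf D.
have dle c : C c -> d <= `|x - c| ^+ 2.
  by move=> Cc; apply: ge_inf; [exists 0 | exists c].
(* With this tolerance the parallelogram identity bounds [|c n - c m|] by
   [harmonic m]. *)
have /choice[c hc] : forall k : nat, exists c,
    C c /\ `|x - c| ^+ 2 < d + (harmonic k / 2) ^+ 2.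
  move=> k; have k0 : 0 < (harmonic k / 2 : R) ^+ 2.
    by rewrite exprn_gt0// divr_gt0// /harmonic/= invr_gt0.
  by have [_ [c Cc <-] h] := inf_adherent k0 hiD; exists c.
have key m n : (m <= n)%N -> `|c n - c m| <= (harmonic m : R).
  move=> mn; rewrite -ler_sqr ?nnegrE ?harmonic_ge0//.
  have := parallelogram (x - c m) (x - c n).
  have -> : x - c m + (x - c n) = 2 *: (x - 2^-1 *: (c m + c n)).
    rewrite scalerBr scalerA divff ?pnatr_eq0// scale1r scaler_nat mulr2n.
    by rewrite opprD addrACA.
  have -> : x - c m - (x - c n) = c n - c m by rewrite opprB addrC subrKA.
  rewrite normrZ exprMn real_normK ?num_real//.
  have := dle _ (midC _ _ (hc m).1 (hc n).1).
  have [_ hm] := hc m; have [_ hn] := hc n.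
  have hmn : (harmonic n / 2 : R) ^+ 2 <= (harmonic m / 2) ^+ 2.
    rewrite ler_sqr ?nnegrE ?divr_ge0 ?harmonic_ge0//.
    rewrite ler_pM2r ?invr_gt0// /harmonic/= lef_pV2 ?posrE//.
    by rewrite ler_nat.
  move: hm hn hmn; rewrite !exprMn; set a := `|_| ^+ 2; set b := `|_| ^+ 2.
  set hn := harmonic n ^+ 2; set hm := harmonic m ^+ 2; set s := `|_| ^+ 2.
  set t := `|_| ^+ 2.
  lra.
have [p hp] := cauchy_rate_cvg key cvg_harmonic.
have cp : c @ \oo --> p by exact: cvg_norm_bound hp cvg_harmonic.
exists p; split.
  have Cc : \forall k \near \oo, C (c k) by apply: nearW => k; exact: (hc k).1.
  exact: closed_cvg clC Cc _ cp.
move=> z Cz; rewrite -ler_sqr ?nnegrE//; apply: le_trans (dle _ Cz).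
have h1 : (fun k => `|x - c k| ^+ 2) @ \oo --> `|x - p| ^+ 2.
  have h : (fun k => `|x - c k|) @ \oo --> `|x - p|.
    by apply: cvg_norm; apply: cvgB => //; exact: cvg_cst.
  exact: (cvgM h h).
have h2 : (fun k => d + (harmonic k / 2) ^+ 2) @ \oo --> d.
  rewrite -[X in _ --> X]addr0; apply: cvgD; first exact: cvg_cst.
  rewrite [X in _ --> X](_ : 0 = (0 / 2) * (0 / 2)); last by rewrite !mul0r.
  have h : (fun k => harmonic k / 2 : R) @ \oo --> (0 / 2 : R).
    by apply: cvgM; [exact: cvg_harmonic|exact: cvg_cst].
  exact: (cvgM h h).
apply: (ler_cvg_to h1 h2).
by apply: nearW => k; apply: ltW; exact: (hc k).2.
Qed.

(** Moving from [p] along [v] by the step [<x - p, v> / |v|^2] would bring [p]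
    strictly closer to [x] unless that step is zero. *)
Lemma orthogonal_of_nearest V x p : (forall (a : R) v, V v -> V (p + a *: v)) ->
  (forall c, V c -> `|x - p| <= `|x - c|) -> forall v, V v -> inner (x - p) v = 0.
Proof.
move=> Vp near v Vv.
have [->|v0] := eqVneq v 0; first by rewrite inner0r.
have vp : 0 < `|v| ^+ 2 by rewrite exprn_gt0// normr_gt0.
pose a := inner (x - p) v / `|v| ^+ 2.
have := near _ (Vp a v Vv).
rewrite -ler_sqr ?nnegrE// opprD addrA [X in _ <= X]sqr_normB normrZ exprMn.
rewrite innerZr real_normK ?num_real//.
have e1 : a * inner (x - p) v = a ^+ 2 * `|v| ^+ 2.
  by rewrite /a; field; rewrite gt_eqF// ; rewrite exprn_gt0 ?normr_gt0 in vp *.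
rewrite e1 => h.
have : a ^+ 2 * `|v| ^+ 2 <= 0 by lra.
rewrite pmulr_lle0// => a2.
have : a == 0 by rewrite -sqrf_eq0 eq_le a2 sqr_ge0.
by rewrite /a mulf_eq0 invr_eq0 (gt_eqF vp) orbF => /eqP.
Qed.

(** By Pythagoras, orthogonality makes [p] the strict minimizer of the distance
    to [x] over [C]. *)
Lemma orth_proj_eq C x p : C p -> (forall c, C c -> inner (x - p) (c - p) = 0) ->
  orth_proj C x = p.
Proof.
move=> Cp orth.
have pyth c : C c -> `|x - c| ^+ 2 = `|x - p| ^+ 2 + `|c - p| ^+ 2.
  move=> Cc; have -> : x - c = (x - p) - (c - p) by rewrite opprB addrA subrK.
  by rewrite sqr_normB orth// mulr0 subr0.
apply: xget_unique.
  split=> // c Cc; rewrite -ler_sqr ?nnegrE// (pyth c)//.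
  by rewrite lerDl sqr_ge0.
move=> q [Cq /(_ _ Cp)]; rewrite -ler_sqr ?nnegrE// (pyth q)//.
rewrite gerDl => h.
by apply/eqP; rewrite -subr_eq0 -normr_eq0 -sqrf_eq0 eq_le h sqr_ge0.
Qed.

Lemma orth_proj_subspace V x : V 0 ->
  (forall (a : R) u v, V u -> V v -> V (a *: u + v)) -> closed V ->
  V (orth_proj V x) /\ forall v, V v -> inner (x - orth_proj V x) v = 0.
Proof.
move=> V0 VL clV.
have [p [Vp near]] : exists p, V p /\ forall c, V c -> `|x - p| <= `|x - c|.
  apply: nearest_point_exists => //; first by exists 0.
  move=> c d Vc Vd; have VDcd : V (c + d) by rewrite -[c]scale1r; exact: VL.
  by rewrite -[_ *: _]addr0; exact: VL.
have orth := @orthogonal_of_nearest V x p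
  (fun a v Vv => eq_ind _ V (VL a v p Vv Vp) _ (addrC _ _)) near.
suff -> : orth_proj V x = p by [].
apply: orth_proj_eq => // c Vc; apply: orth.
by rewrite addrC -scaleN1r; exact: VL.
Qed.

End Projection.

Lemma closure_distP (R : realType) (V : normedModType R) (C : set V) (p : V) :
  closure C p <-> forall e : R, 0 < e -> exists2 c, C c & `|p - c| < e.
Proof.
split=> [clp e e0|h B /nbhs_ballP[e /= e0 eB]].
  have [c [Cc]] := clp _ (nbhsx_ballx p e e0).
  by rewrite -ball_normE; exists c.
have [c Cc pc] := h e e0; exists c; split => //.
by apply: eB; rewrite -ball_normE.
Qed.

Lemma closure_linear (R : realType) (V : normedModType R) (C : set V) :
  (forall (a : R) u v, C u -> C v -> C (a *: u + v)) ->
  forall (a : R) u v, closure C u -> closure C v -> closure C (a *: u + v).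
Proof.
move=> CL a u v /closure_distP uC /closure_distP vC.
apply/closure_distP => e e0.
have a0 : 0 < `|a| + 1 by rewrite ltr_pwDr.
have e2 : 0 < e / 2 by rewrite divr_gt0.
have [c Cc uc] := uC _ (divr_gt0 e2 a0).
have [d Cd vd] := vC _ e2.
exists (a *: c + d); first exact: CL.
have -> : a *: u + v - (a *: c + d) = a *: (u - c) + (v - d).
  by rewrite scalerBr opprD addrACA.
rewrite (le_lt_trans (ler_normD _ _))// [ltRHS](splitr e).
apply: ltr_leD; last exact: ltW.
rewrite normrZ; move: uc; rewrite ltr_pdivlMr//; apply: le_lt_trans.
by rewrite mulrC ler_wpM2l// lerDl.
Qed.

Section Adjoint.
Variables (R : realType) (X Y : hilbertType R) (A : {linear X -> Y}).
Hypothesis A_bounded : bounded_op A.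

(** The representative is a multiple of the component orthogonal to the kernel
    of any vector on which [phi] does not vanish. *)
Lemma Riesz (phi : {linear X -> R^o}) : bounded_op phi ->
  exists z, forall x, phi x = inner x z.
Proof.
move=> phib.
have [phi0|] := pselect (forall x, phi x = 0).
  by exists 0 => x; rewrite inner0r phi0.
move=> /existsNP[z0 /eqP z0n].
pose K := [set x | phi x = 0].
have clK : closed K.
  have phic := bounded_op_continuous phib.
  have -> : K = phi @^-1` [set 0] by [].
  by move/continuous_closedP : phic; apply; exact: closed_eq.
have K0 : K 0 by rewrite /K/= linear0.
have KL (a : R) u v : K u -> K v -> K (a *: u + v).
  by rewrite /K/= linearP => -> ->; rewrite scaler0 addr0.
have [pK orth] := orth_proj_subspace z0 K0 KL clK.
set z := z0 - _ in orth.
have phiz : phi z = phi z0.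
  have pK0 : phi (orth_proj K z0) = 0 by exact: pK.
  by rewrite /z linearB pK0 subr0.
have zn : `|z| ^+ 2 != 0.
  rewrite sqrf_eq0 normr_eq0; apply: contra z0n => /eqP z_0.
  by rewrite -phiz z_0 linear0.
exists ((phi z0 / `|z| ^+ 2) *: z) => x.
have Kx : K (- (phi x / phi z0) *: z + x).
  rewrite /K/= linearP phiz /= -[_ *: _]/(_ * _).
  by rewrite mulNr divfK// addNr.
have := orth _ Kx; rewrite innerDr innerZr inner_norm => h.
rewrite innerZr (innerC x).
have -> : inner z x = phi x / phi z0 * `|z| ^+ 2 by lra.
by field; rewrite z0n -sqrf_eq0.
Qed.

(** By Riesz representation the set that defines [adjoint A] is nonempty, so its
    chosen element has the defining property. *)
Lemma adjointE x y : inner (A x) y = inner x (adjoint A y).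
Proof.
pose phi (x : X) : R^o := inner (A x) y.
have phiL : linear phi by move=> a u v; rewrite /phi linearP innerDl innerZl.
pose phi_lin : {linear X -> R^o} :=
  HB.pack phi (GRing.isLinear.Build R X R^o _ phi phiL).
have phib : bounded_op phi_lin.
  have [M M0 hM] := bounded_op_ge0 A_bounded.
  exists (M * `|y|) => u; apply: le_trans (Cauchy_Schwarz _ _) _.
  by rewrite mulrAC ler_wpM2r.
have [z hz] := Riesz phib.
by have := @xgetPex _ 0 [set z | forall x, inner (A x) y = inner x z]
  (ex_intro _ z hz); apply.
Qed.

Lemma adjoint_linear : linear (adjoint A).
Proof.
move=> a u v; apply: inner_eq_all => w.
by rewrite -adjointE !innerDr !innerZr -!adjointE.
Qed.

End Adjoint.

(** * Polynomials of an operator *)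

Section PolyOp.
Variables (R : realType) (X : normedModType R) (T : {linear X -> X}).
Implicit Types (p q : {poly R}) (x u v : X).

(** Lets polynomials of different degrees be compared as sums over the same
    range. *)
Lemma poly_op_widen n p x : (size p <= n)%N ->
  poly_op p T x = \sum_(i < n) p`_i *: iter i T x.
Proof.
move=> pn; rewrite /poly_op.
rewrite (big_ord_widen n (fun i => p`_i *: iter i T x))//.
rewrite [RHS](bigID (fun i : 'I_n => (i < size p)%N))/=.
rewrite [X in _ = _ + X]big1 ?addr0// => i.
by rewrite -leqNgt => ?; rewrite nth_default// scale0r.
Qed.

Lemma poly_opD p q x : poly_op (p + q) T x = poly_op p T x + poly_op q T x.
Proof.
pose n := maxn (size p) (size q).
rewrite (@poly_op_widen n) ?size_polyD//.
rewrite (@poly_op_widen n p) ?leq_maxl// (@poly_op_widen n q) ?leq_maxr//.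
by rewrite -big_split; apply: eq_bigr => i _; rewrite coefD scalerDl.
Qed.

Lemma poly_opZ (a : R) p x : poly_op (a *: p) T x = a *: poly_op p T x.
Proof.
rewrite (@poly_op_widen (size p)) ?size_scale_leq//.
by rewrite /poly_op scaler_sumr; apply: eq_bigr => i _; rewrite coefZ scalerA.
Qed.

Lemma poly_opB p q x : poly_op (p - q) T x = poly_op p T x - poly_op q T x.
Proof. by rewrite poly_opD -scaleN1r poly_opZ scaleN1r. Qed.

Lemma poly_opC (c : R) x : poly_op c%:P T x = c *: x.
Proof.
by rewrite (@poly_op_widen 1) ?size_polyC_leq1// big_ord1 coefC.
Qed.

Lemma poly_op0 x : poly_op 0 T x = 0.
Proof. by rewrite -[0]/(0%:P) poly_opC scale0r. Qed.

Lemma poly_op1 x : poly_op 1 T x = x.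
Proof. by rewrite -[1]/(1%:P) poly_opC scale1r. Qed.

Lemma poly_opMX p x : poly_op (p * 'X) T x = poly_op p T (T x).
Proof.
rewrite (@poly_op_widen (size p).+1); last first.
  by rewrite (leq_trans (size_polyMleq _ _))// size_polyX addn2.
rewrite big_ord_recl/= coefMX/= scale0r add0r.
by apply: eq_bigr => i _; rewrite coefMX/= -iterS iterSr.
Qed.

Lemma poly_opXM p x : poly_op ('X * p) T x = T (poly_op p T x).
Proof.
rewrite (@poly_op_widen (size p).+1); last first.
  by rewrite (leq_trans (size_polyMleq _ _))// size_polyX.
rewrite big_ord_recl/= coefXM/= scale0r add0r linear_sum.
by apply: eq_bigr => i _; rewrite coefXM/= linearZ.
Qed.

Lemma poly_opX x : poly_op 'X T x = T x.
Proof. by rewrite -['X]mulr1 poly_opXM poly_op1. Qed.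

Lemma poly_opM p q x : poly_op (p * q) T x = poly_op p T (poly_op q T x).
Proof.
elim/poly_ind: p q => [|p c IH] q; first by rewrite mul0r !poly_op0.
rewrite mulrDl -mulrA mul_polyC !poly_opD IH poly_opMX poly_opXM poly_opZ.
by rewrite poly_opC.
Qed.

Lemma poly_op_linear p : linear (poly_op p T).
Proof.
move=> a u v; elim/poly_ind: p u v => [|p c IH] u v.
  by rewrite !poly_op0 scaler0 addr0.
rewrite !poly_opD !poly_opMX linearP IH !poly_opC !scalerDr !scalerA.
by rewrite (mulrC c) addrACA.
Qed.

Lemma poly_op_bounded p : bounded_op T -> bounded_op (poly_op p T).
Proof.
move=> /bounded_op_ge0[M M0 hM].
suff [N N0 hN] : exists2 N, 0 <= N & forall x, `|poly_op p T x| <= N * `|x|.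
  by exists N.
elim/poly_ind: p => [|p c [N N0 hN]].
  by exists 0 => // x; rewrite poly_op0 normr0 mul0r.
exists (N * M + `|c|); first by rewrite addr_ge0 ?mulr_ge0.
move=> x; rewrite poly_opD poly_opMX poly_opC mulrDl.
rewrite (le_trans (ler_normD _ _))// normrZ lerD2r.
by rewrite (le_trans (hN _))// -mulrA ler_wpM2l.
Qed.

End PolyOp.

HB.instance Definition _ (R : realType) (X : normedModType R)
  (p : {poly R}) (T : {linear X -> X}) :=
  GRing.isLinear.Build R X X *:%R (poly_op p T) (poly_op_linear T p).

(** * Approximate point spectrum *)

Definition bounded_below (R : realType) (U V : normedModType R) (T : U -> V) :=
  exists2 c : R, 0 < c & forall x, c * `|x| <= `|T x|.

Definition approx_point_spectrum (R : realType) (X : normedModType R)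
  (T : X -> X) : set R := [set t | ~ bounded_below (fun x => T x - t *: x)].

Lemma bounded_below_comp (R : realType) (U V W : normedModType R)
  (S : V -> W) (T : U -> V) :
  bounded_below S -> bounded_below T -> bounded_below (S \o T).
Proof.
move=> [c c0 hc] [d d0 hd]; exists (c * d); first exact: mulr_gt0.
by move=> x; rewrite -mulrA (le_trans _ (hc _))// ler_pM2l.
Qed.

(** If [S] is a left inverse of [T - t] and [M] bounds it, then
    [|x| <= M |(T - t) x|]. *)
Lemma approx_point_spectrum_sub_spectrum (R : realType)
  (X : normedModType R) (T : X -> X) :
  approx_point_spectrum T `<=` spectrum T.
Proof.
move=> t /= nb [S [Slin /bounded_op_ge0[M M0 hM] TS ST]]; apply: nb.
exists (M + 1)^-1; first by rewrite invr_gt0 ltr_pwDr.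
move=> x; rewrite mulrC ler_pdivrMr ?ltr_pwDr// -{1}(TS x).
by apply: le_trans (hM _) _; rewrite mulrC ler_wpM2l// lerDl.
Qed.

Lemma approx_point_spectrum_le_opnorm (R : realType) (X : normedModType R)
  (T : {linear X -> X}) (t : R) : bounded_op T ->
  approx_point_spectrum T t -> `|t| <= opnorm T.
Proof.
move=> Tb tT; rewrite leNgt; apply/negP => Lt; apply: tT.
exists (`|t| - opnorm T); first by rewrite subr_gt0.
move=> x; rewrite mulrBl lerBlDr -normrZ.
apply: le_trans (lerD (lexx _) (opnormP Tb x)).
by rewrite -lerBlDr distrC; exact: lerB_dist.
Qed.

(** For negative [t], positivity of [T] gives [<(T - t) x, x> >= - t |x|^2]. *)
Lemma approx_point_spectrum_ge0 (R : realType) (X : hilbertType R)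
  (T : {linear X -> X}) (t : R) :
  (forall x, 0 <= inner (T x) x) -> approx_point_spectrum T t -> 0 <= t.
Proof.
move=> Tpos tT; rewrite leNgt; apply/negP => t0; apply: tT.
exists (- t); first by rewrite oppr_gt0.
move=> x; have [->|x0] := eqVneq x 0; first by rewrite normr0 mulr0.
have xp : 0 < `|x| by rewrite normr_gt0.
rewrite -(ler_pM2r xp); apply: le_trans (inner_le _ _).
by rewrite innerBl innerZl inner_norm -mulrA -expr2 mulNr lerDr Tpos.
Qed.

(** * Spectral bound for polynomials of a symmetric operator *)

Section RealFactor.
Import complex.

(** A nonconstant real polynomial has a complex root [a + b i].  If [b] is
    nonzero, the remainder modulo the quadratic [(X - a)^2 + b^2] has degree at
    most one and a nonreal root, so it vanishes. *)
Lemma real_poly_factor (R : rcfType) (q : {poly R}) : (1 < size q)%N ->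
  (exists a, root q a) \/
  exists a b, b != 0 /\ (('X - a%:P) ^+ 2 + (b ^+ 2)%:P) %| q.
Proof.
move=> q1; pose rc := (@real_complex R : {rmorphism R -> complex R}).
have /closed_rootP[[a b] qz] : size (map_poly rc q) != 1%N.
  by rewrite size_map_poly; case: (size q) q1 => [|[]].
have [b0|b0] := eqVneq b 0.
  left; exists a; rewrite -(fmorph_root rc); move: qz.
  by rewrite b0.
right; exists a, b; split=> //.
set d := _ + _.
have sd : size d = 3%N.
  rewrite size_polyDl ?size_exp_XsubC// (leq_ltn_trans (size_polyC_leq1 _))//.
pose z := Complex a b.
have dz : (map_poly rc d).[z] = 0.
  rewrite /d rmorphD rmorphXn rmorphB/= map_polyX !map_polyC !hornerE/=.
  apply/eqP; rewrite eq_complex/=.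
  by apply/andP; split; apply/eqP; ring.
have rz : (map_poly rc (q %% d)).[z] = 0.
  move/rootP : qz; rewrite [in map_poly rc q](divp_eq q d) rmorphD rmorphM/=.
  by rewrite hornerD hornerM dz mulr0 add0r.
have d0 : d != 0 by rewrite -size_poly_gt0 sd.
have sr : (size (q %% d)%R <= 2)%N by rewrite -ltnS -sd ltn_modp.
move: rz; rewrite (horner_coef_wide _ (n := 2)) ?size_map_poly//.
rewrite big_ord_recl big_ord1 /= !coef_map/= expr0 expr1 mulr1.
move=> /eqP; rewrite eq_complex/= => /andP[/eqP hre /eqP him].
have r1 : (q %% d)`_1 = 0.
  apply/eqP; move/eqP: him; rewrite !mul0r ?addr0 ?add0r mulf_eq0.
  by rewrite (negbTE b0) orbF.
have r0 : (q %% d)`_0 = 0.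
  by move: hre; rewrite r1 !mul0r subr0 addr0.
apply/eqP/polyP => -[|[|i]]; rewrite coef0 ?r0 ?r1//.
by rewrite nth_default// (leq_trans sr).
Qed.
End RealFactor.

Section Symmetric.
Variables (R : realType) (X : hilbertType R) (T : {linear X -> X}).
Hypothesis T_bounded : bounded_op T.
Hypothesis T_sym : forall u v, inner (T u) v = inner u (T v).
Implicit Types p q : {poly R}.

Lemma poly_op_sym p u v : inner (poly_op p T u) v = inner u (poly_op p T v).
Proof.
elim/poly_ind: p u v => [|p c IH] u v.
  by rewrite !poly_op0 inner0l inner0r.
rewrite !poly_opD !poly_opC innerDl innerDr innerZl innerZr poly_opMX IH T_sym.
by rewrite -poly_opXM mulrC.
Qed.

(** [<((T - a)^2 + b^2) x, x> = |(T - a) x|^2 + b^2 |x|^2] for symmetric [T]. *)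
Lemma bounded_below_quadratic (a b : R) : b != 0 ->
  bounded_below (poly_op (('X - a%:P) ^+ 2 + (b ^+ 2)%:P) T).
Proof.
move=> b0; have b2 : 0 < b ^+ 2 by rewrite lt_def sqr_ge0 sqrf_eq0 b0.
exists (b ^+ 2) => // x.
have [->|x0] := eqVneq x 0; first by rewrite normr0 mulr0.
have xp : 0 < `|x| by rewrite normr_gt0.
rewrite -(ler_pM2r xp); apply: le_trans (inner_le _ _).
rewrite poly_opD poly_opC (expr2 ('X - _)) poly_opM innerDl poly_op_sym innerZl.
by rewrite !inner_norm -mulrA -(expr2 `|x|) lerDr sqr_ge0.
Qed.

(** Induction on the degree: each linear factor is bounded below because its
    root lies outside the approximate point spectrum, and each irreducible
    quadratic factor always is. *)
Lemma bounded_below_poly_op q : q != 0 ->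
  (forall t, approx_point_spectrum T t -> q.[t] != 0) ->
  bounded_below (poly_op q T).
Proof.
move: {2}(size q) (leqnn (size q)) => n; elim: n q => [|n IH] q.
  by rewrite size_poly_leq0 => ->.
move=> sq q0 qroot.
have [s1|s1] := leqP (size q) 1.
  have qE := size1_polyC s1; have c0 : q`_0 != 0.
    by apply: contraNneq q0 => c0; rewrite qE c0.
  exists `|q`_0|; first by rewrite normr_gt0.
  by move=> x; rewrite [in leRHS]qE poly_opC normrZ.
have step d : d %| q -> (1 < size d)%N -> bounded_below (poly_op d T) ->
    bounded_below (poly_op q T).
  move=> dq sd bd; rewrite -(divpK dq).
  have e0 : q %/ d != 0.
    by apply: contraNneq q0 => e0; rewrite -(divpK dq) e0 mul0r.
  have d0 : d != 0 by rewrite -size_poly_gt0 ltnW.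
  suff be : bounded_below (poly_op (q %/ d) T).
    have -> : poly_op (q %/ d * d) T = poly_op (q %/ d) T \o poly_op d T.
      by apply/funext => x; rewrite poly_opM.
    exact: bounded_below_comp.
  apply: IH => //.
    rewrite -ltnS (leq_trans _ sq)// -[in X in (_ < X)%N](divpK dq).
    rewrite size_mul//; move: sd; case: (size d) => [|[|m]]// _.
    by rewrite !addnS /= ltnS leq_addr.
  move=> t /qroot; apply: contraNneq => qt.
  by rewrite -(divpK dq) hornerM qt mul0r.
have [[a qa]|[a [b [b0 dq]]]] := real_poly_factor s1.
  apply: (step ('X - a%:P)); rewrite ?size_XsubC// ?dvdp_XsubCl//.
  have -> : poly_op ('X - a%:P) T = (fun x => T x - a *: x).
    by apply/funext => x; rewrite poly_opB poly_opX poly_opC.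
  by apply: contrapT => /qroot; rewrite (rootP qa) eqxx.
apply: step dq _ (bounded_below_quadratic _ b0).
rewrite size_polyDl size_exp_XsubC//.
by rewrite (leq_ltn_trans (size_polyC_leq1 _)).
Qed.

(** If the norm [s] of [p(T)] exceeded [c], then [q = s^2 - p^2] would have no
    root on the approximate point spectrum, and [q(T)] would be bounded below by
    some [e > 0].  But expanding the square gives
    [|q(T) v|^2 <= s^2 (s^2 |v|^2 - |p(T) v|^2)],
    so [|p(T) v|^2 <= (s^2 - e^2 / s^2) |v|^2], and [s] would not be the norm.
    The degree hypothesis ensures that [q] is nonzero. *)
Lemma poly_op_le_of_size p (c : R) : (1 < size p)%N -> 0 <= c ->
  (forall t, approx_point_spectrum T t -> `|p.[t]| <= c) ->
  forall u, `|poly_op p T u| <= c * `|u|.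
Proof.
move=> sp c0 hc u.
have pb := poly_op_bounded p T_bounded.
set s := opnorm (poly_op p T).
have hs v : `|poly_op p T v| <= s * `|v| by exact: opnormP.
have s0 : 0 <= s by exact: opnorm_ge0.
have [sc|cs] := leP s c; first by rewrite (le_trans (hs _))// ler_wpM2r.
exfalso.
have sgt0 : 0 < s by exact: le_lt_trans cs.
pose q := (s ^+ 2)%:P - p * p.
have q0 : q != 0.
  rewrite subr_eq0; apply/eqP => /(congr1 (fun r : {poly R} => size r)).
  rewrite size_mul ?size_polyC; last 2 first.
  - by rewrite -size_poly_gt0 ltnW.
  - by rewrite -size_poly_gt0 ltnW.
  by move: sp; case: (size p) => [|[|k]]// _; rewrite addnS; case: (_ != _).
have qroot t : approx_point_spectrum T t -> q.[t] != 0.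
  move=> /hc ptc; rewrite !hornerE subr_eq0 gt_eqF//.
  rewrite -expr2 -real_normK ?num_real//.
  by rewrite ltr_sqr ?nnegrE//; exact: le_lt_trans cs.
have [e e0 he] := bounded_below_poly_op q0 qroot.
have key v : e ^+ 2 * `|v| ^+ 2 <=
    s ^+ 2 * (s ^+ 2 * `|v| ^+ 2 - `|poly_op p T v| ^+ 2).
  rewrite -exprMn.
  have : (e * `|v|) ^+ 2 <= `|poly_op q T v| ^+ 2.
    by rewrite ler_sqr ?nnegrE ?mulr_ge0 ?(ltW e0).
  rewrite poly_opB poly_opC poly_opM sqr_normB normrZ exprMn.
  rewrite innerZl -poly_op_sym inner_norm (ger0_norm (sqr_ge0 _)).
  have : `|poly_op p T (poly_op p T v)| ^+ 2 <= s ^+ 2 * `|poly_op p T v| ^+ 2.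
    by rewrite -exprMn ler_sqr ?nnegrE ?mulr_ge0.
  rewrite exprMn; lra.
(* The maximum with [0] keeps the square root meaningful. *)
pose k := Num.max (s ^+ 2 - e ^+ 2 / s ^+ 2) 0.
have k0 : 0 <= k by rewrite le_max lexx orbT.
have s2 : 0 < s ^+ 2 by rewrite exprn_gt0.
have hk v : `|poly_op p T v| <= Num.sqrt k * `|v|.
  rewrite -ler_sqr ?nnegrE ?mulr_ge0 ?sqrtr_ge0// exprMn sqr_sqrtr//.
  have kv : (s ^+ 2 - e ^+ 2 / s ^+ 2) * `|v| ^+ 2 <= k * `|v| ^+ 2.
    by rewrite ler_wpM2r ?sqr_ge0// le_max lexx.
  apply: le_trans kv; have := key v.
  rewrite -ler_pdivrMl// mulrBl => h.
  by rewrite mulrAC [_ / _]mulrC; lra.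
have : Num.sqrt k < s.
  rewrite -ltr_sqr ?nnegrE ?sqrtr_ge0// sqr_sqrtr// gt_max.
  by rewrite gtrDl oppr_lt0 divr_gt0 ?exprn_gt0.
by rewrite ltNge opnorm_le ?sqrtr_ge0.
Qed.

(** For a constant polynomial the bound is immediate as soon as the approximate
    point spectrum has an element.  If it were empty, the nonconstant case with
    bound [0] for [X] and for [X + 1] would force the space to be trivial. *)
Lemma poly_op_le p (c : R) : 0 <= c ->
  (forall t, approx_point_spectrum T t -> `|p.[t]| <= c) ->
  forall u, `|poly_op p T u| <= c * `|u|.
Proof.
move=> c0 hc u.
have [sp|sp] := leqP (size p) 1; last exact: poly_op_le_of_size.
rewrite (size1_polyC sp) poly_opC normrZ.
have [[t /hc]|noap] := pselect (exists t, approx_point_spectrum T t).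
  by rewrite {1}(size1_polyC sp) hornerC => ?; rewrite ler_wpM2r.
have T0 : `|poly_op 'X T u| <= 0 * `|u|.
  apply: poly_op_le_of_size; rewrite ?size_polyX// => t tT.
  by case: noap; exists t.
have T1 : `|poly_op ('X + 1%:P) T u| <= 0 * `|u|.
  apply: poly_op_le_of_size; rewrite ?size_XaddC// => t tT.
  by case: noap; exists t.
suff -> : u = 0 by rewrite normr0 !mulr0.
move: T1 T0; rewrite mul0r !normr_le0 poly_opD poly_opX poly_opC scale1r.
by move=> Tu /eqP T0; move: Tu; rewrite T0 add0r => /eqP.
Qed.

End Symmetric.

(** * Functional calculus *)

Lemma poly_bounded_on_ball (R : realType) (m : {poly R}) (L : R) : 0 <= L ->
  exists2 M, 0 <= M & forall t, `|t| <= L -> `|m.[t]| <= M.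
Proof.
move=> L0; elim/poly_ind: m => [|p c [N N0 hN]].
  by exists 0 => // t _; rewrite horner0 normr0.
exists (N * L + `|c|); first by rewrite addr_ge0 ?mulr_ge0.
move=> t tL; rewrite !hornerE (le_trans (ler_normD _ _))// lerD2r normrM.
by rewrite ler_pM// hN.
Qed.

Lemma uniform_cvg_dist (R : realType) (A : set R) (p : nat -> R -> R)
  (phi : R -> R) (e : R) : 0 < e -> {uniform A, p @ \oo --> phi} ->
  \forall k \near \oo, forall t, A t -> `|phi t - p k t| < e.
Proof.
move=> e0 pphi.
pose E := [set z : R * R | `|z.1 - z.2| < e].
have entE : entourage E.
  by rewrite -entourage_ballE; exists e => // z /=; rewrite -ball_normE.
have : nbhs (phi : {uniform` A -> R}) [set h | forall t, A t -> E (phi t, h t)].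
  by apply/uniform_nbhs; exists E; split; [exact: entE|exact: subset_refl].
by move=> /pphi.
Qed.

(** For [S = phi(T)] and [p_k] close to [phi], the quantity
    [<m(T) p_k(T) w, p_k(T) w>] equals [<(m p_k^2)(T) w, w>], which [poly_op_le]
    bounds, and it tends to [<m(T) S w, S w>].  If the functional calculus takes
    its default value [0], the left-hand side is [0]. *)
Lemma inner_fun_calc_le (R : realType) (X : hilbertType R) (T : {linear X -> X})
  (phi : R -> R) (m : {poly R}) (c : R) :
  bounded_op T -> (forall u v, inner (T u) v = inner u (T v)) -> 0 <= c ->
  (forall t, approx_point_spectrum T t -> `|m.[t]| * phi t ^+ 2 <= c) ->
  forall w, inner (poly_op m T (fun_calc phi T w)) (fun_calc phi T w)
    <= c * `|w| ^+ 2.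
Proof.
move=> Tb Ts c0 hc w; rewrite /fun_calc.
case: xgetP => [S _ [Slin Sb [p [pphi pS]]]|_]; last first.
  by rewrite inner0r mulr_ge0// sqr_ge0.
have [M M0 hM] := poly_bounded_on_ball m (opnorm_ge0 Tb).
have pSw : (fun k => poly_op (p k) T w) @ \oo --> S w.
  apply: (@cvg_norm_bound _ _ _ _
    (fun k => opnorm (fun x => poly_op (p k) T x - S x) * `|w|)).
    move=> k; have [g gE] : exists g : {linear X -> X},
        (fun x => poly_op (p k) T x - S x) = g.
      apply: linear_ex => a u v.
      by rewrite Slin linearP/= scalerBr opprD addrACA.
    have gb : bounded_op g.
      have [N1 N10 hN1] := bounded_op_ge0 (poly_op_bounded (p k) Tb).
      have [N2 N20 hN2] := bounded_op_ge0 Sb.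
      exists (N1 + N2) => x; rewrite -gE (le_trans (ler_normB _ _))// mulrDl.
      exact: lerD.
    by have := opnormP gb w; rewrite -gE distrC.
  rewrite -[X in _ --> X](mul0r `|w|).
  by apply: cvgM => //; exact: cvg_cst.
have lhs := cvg_inner (bounded_op_cvg (poly_op_bounded m Tb) pSw) pSw.
apply/ler_addgt0Pr => e e0.
(* A uniform error [d <= 1] on the spectrum costs at most
   [d * (c + 2 * M) * |w| ^ 2]; the added [1] keeps [K] positive. *)
pose K := (c + 2 * M) * `|w| ^+ 2 + 1.
have K0 : 0 < K.
  by rewrite ltr_pwDr// mulr_ge0 ?sqr_ge0// addr_ge0// mulr_ge0.
pose d := Num.min 1 (e / K).
have d0 : 0 < d by rewrite lt_min ltr01 divr_gt0.
apply: (ler_cvg_to lhs (cvg_cst (c * `|w| ^+ 2 + e))).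
have := uniform_cvg_dist d0 pphi; apply: filterS => k hk.
have d1 : d <= 1 by rewrite ge_min lexx.
have dK : d * K <= e by rewrite -ler_pdivlMr// ge_min lexx orbT.
have : `|poly_op (m * (p k * p k)) T w| <= (c + d * (c + 2 * M)) * `|w|.
  apply: (poly_op_le Tb Ts).
    by rewrite addr_ge0// mulr_ge0 ?(ltW d0)// addr_ge0// mulr_ge0.
  move=> t tT; rewrite !hornerM !normrM -expr2.
  have pk : `|(p k).[t]| <= `|phi t| + d.
    rewrite -lerBlDl; apply: le_trans (lerB_dist _ _) _.
    by rewrite distrC ltW// hk//; exact: approx_point_spectrum_sub_spectrum.
  have mt := hM _ (approx_point_spectrum_le_opnorm Tb tT).
  have := hc t tT; rewrite -[phi t ^+ 2]real_normK ?num_real//.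
  have : `|(p k).[t]| ^+ 2 <= (`|phi t| + d) ^+ 2.
    by rewrite ler_sqr ?nnegrE ?addr_ge0// ltW.
  have : 0 <= `|m.[t]| by [].
  set a := `|m.[t]| in mt *; set f := `|phi t|; set q := _ ^+ 2.
  (* From [2 f <= 1 + f ^ 2] and [d ^ 2 <= d]. *)
  have f2 : (f + d) ^+ 2 <= (1 + d) * f ^+ 2 + 2 * d.
    have := sqr_ge0 (f - 1); nra.
  move=> a0 hq hcf.
  have h1 : a * q <= a * ((1 + d) * f ^+ 2 + 2 * d).
    by rewrite ler_wpM2l// (le_trans hq).
  apply: le_trans h1 _.
  have h2 : (1 + d) * (a * f ^+ 2) <= (1 + d) * c.
    by rewrite ler_wpM2l// addr_ge0// ltW.
  have h3 : d * a <= d * M by rewrite ler_wpM2l// ltW.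
  lra.
have -> : inner (poly_op m T (poly_op (p k) T w)) (poly_op (p k) T w)
    = inner (poly_op (m * (p k * p k)) T w) w.
  by rewrite mulrCA !poly_opM [RHS](poly_op_sym Ts).
move=> hle; apply: le_trans (inner_le _ _) _.
apply: (@le_trans _ _ ((c + d * (c + 2 * M)) * `|w| * `|w|)).
  by rewrite ler_wpM2r.
rewrite -mulrA -expr2 mulrDl lerD2l; apply: le_trans dK.
by rewrite -mulrA ler_pM2l// lerDl.
Qed.

(** * Scalar estimates *)

Section Scalar.
Variable R : realType.
Implicit Types (lambda L nu t d : R).

(** Both [1 - lambda t] and [lambda t - 1] are at most [1 - d t] on [[0, L]] for
    [d] the minimum of [lambda] and [2 / L - lambda]; the second bound is where
    [lambda L < 2] enters. *)
Lemma landweber_factor_le_expR lambda L : 0 < lambda -> 0 < L -> lambda * L < 2 ->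
  exists2 d, 0 < d & forall t, 0 <= t -> t <= L ->
    `|1 - lambda * t| <= expR (- (d * t)).
Proof.
move=> l0 L0 lL.
exists (Num.min lambda (2 / L - lambda)).
  by rewrite lt_min l0 subr_gt0 ltr_pdivlMr.
set d := Num.min _ _ => t t0 tL.
apply: le_trans (expR_ge1Dx _).
have dl : d * t <= lambda * t by rewrite ler_wpM2r// ge_min lexx.
have dL : d * t <= (2 / L - lambda) * t by rewrite ler_wpM2r// ge_min lexx orbT.
have tL2 : 2 / L * t <= 2 by rewrite mulrAC ler_pdivrMr// ler_pM2l.
rewrite ler_norml; apply/andP; split; lra.
Qed.

(** With [u = n d t / nu], this is [u^nu <= (exp u)^nu]. *)
Lemma expR_powR_le nu d t n : 0 < nu -> 0 < d -> 0 <= t -> (0 < n)%N ->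
  expR (- (d * t)) ^+ n * t `^ nu <= (nu / d) `^ nu * n%:R `^ (- nu).
Proof.
move=> nu0 d0 t0 n0; have nR : 0 < n%:R :> R by rewrite ltr0n.
pose u := n%:R * d * t / nu.
have u0 : 0 <= u by rewrite divr_ge0 ?mulr_ge0// ltW.
have -> : expR (- (d * t)) ^+ n = (expR u `^ nu)^-1.
  rewrite -expRM -expRM_natl -expRN; congr expR.
  by rewrite /u; field; rewrite gt_eqF.
have tE : t = u * (nu / d * n%:R `^ (-1)).
  by rewrite powR_inv1 ?ltW// /u; field; rewrite !gt_eqF.
have c0 : 0 <= nu / d by rewrite divr_ge0 ?ltW.
have q0 : 0 <= nu / d * n%:R `^ (-1) :> R by apply: mulr_ge0 => //; exact: powR_ge0.
rewrite tE (powRM _ u0 q0) (powRM _ c0 (powR_ge0 _ _)).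
rewrite -powRrM mulN1r mulrA ler_piMl ?mulr_ge0 ?powR_ge0//.
rewrite mulrC ler_pdivrMr ?powR_gt0 ?expR_gt0// mul1r.
rewrite ge0_ler_powR ?nnegrE ?expR_ge0 ?(ltW nu0)//.
by apply: le_trans (expR_ge1Dx u); rewrite lerDr.
Qed.

Lemma landweber_filter_le lambda L nu : 0 < lambda -> 0 < L -> lambda * L < 2 ->
  0 < nu -> exists2 C, 0 < C & forall t n, 0 <= t -> t <= L -> (0 < n)%N ->
    `|1 - lambda * t| ^+ n * t `^ nu <= C * n%:R `^ (- nu).
Proof.
move=> l0 L0 lL nu0; have [d d0 hd] := landweber_factor_le_expR l0 L0 lL.
exists ((nu / d) `^ nu); first by rewrite powR_gt0// divr_gt0.
move=> t n t0 tL n0; apply: le_trans (expR_powR_le nu0 d0 t0 n0).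
by rewrite ler_wpM2r ?powR_ge0// lerXn2r ?nnegrE ?expR_ge0 ?hd.
Qed.

Lemma powRN_cvg0 mu : 0 < mu ->
  (fun n : nat => n.+1%:R `^ (- mu)) @ \oo --> (0 : R).
Proof.
move=> mu0.
have hE n : n.+1%:R `^ (- mu) = harmonic n `^ mu :> R.
  by rewrite -mulN1r powRrM powR_inv1.
under eq_fun do rewrite hE.
move/cvg_at_rightP : (powR_cvg0 mu0); apply; split; last exact: cvg_harmonic.
by move=> n; rewrite /harmonic/= invr_gt0.
Qed.

End Scalar.

(** * The Landweber iteration *)

Section Landweber.
Variables (R : realType) (X Y : hilbertType R).
Variables (A : {linear X -> Y}) (As : {linear Y -> X}).
Hypothesis A_bounded : bounded_op A.
(* The adjoint enters through its adjunction with [A], bundled as a linear map,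
   so that [A \o As] is itself a linear map. *)
Hypothesis adjE : forall x y, inner (A x) y = inner x (As y).

Let B : {linear Y -> Y} := A \o As.

Lemma adjoint_bounded : bounded_op As.
Proof.
have [M M0 hM] := bounded_op_ge0 A_bounded; exists M => y.
have [->|y0] := eqVneq (As y) 0; first by rewrite normr0 mulr_ge0.
have yp : 0 < `|As y| by rewrite normr_gt0.
rewrite -(ler_pM2l yp) -expr2 -inner_norm -adjE.
apply: le_trans (inner_le _ _) _.
by rewrite mulrCA mulrA ler_wpM2r.
Qed.

Lemma normal_op_bounded : bounded_op B.
Proof.
have [M M0 hM] := bounded_op_ge0 A_bounded.
have [N N0 hN] := bounded_op_ge0 adjoint_bounded.
exists (M * N) => y; rewrite /= (le_trans (hM _))// -mulrA.
by rewrite ler_wpM2l//; exact: hN.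
Qed.

Lemma normal_op_sym u v : inner (B u) v = inner u (B v).
Proof. by rewrite [LHS]adjE [RHS]innerC [RHS]adjE innerC. Qed.

Lemma normal_op_ge0 u : 0 <= inner (B u) u.
Proof. by rewrite [leRHS]adjE inner_norm sqr_ge0. Qed.

(** With [L = ||A* A||], [|A x|^2 = <x, A* A x> <= L |x|^2], and by duality [A*]
    satisfies the same bound [sqrt L]. *)
Lemma opnorm_normal_op_le : opnorm B <= opnorm (As \o A).
Proof.
have AsAb : bounded_op (As \o A).
  have [M M0 hM] := bounded_op_ge0 A_bounded.
  have [N N0 hN] := bounded_op_ge0 adjoint_bounded.
  exists (N * M) => x; rewrite /= (le_trans (hN _))// -mulrA.
  by rewrite ler_wpM2l.
set L := opnorm (As \o A).
have L0 : 0 <= L by exact: (opnorm_ge0 AsAb).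
have hA x : `|A x| <= Num.sqrt L * `|x|.
  rewrite -ler_sqr ?nnegrE ?mulr_ge0 ?sqrtr_ge0// exprMn sqr_sqrtr//.
  rewrite -inner_norm adjE innerC (le_trans (inner_le _ _))//.
  by rewrite expr2 mulrA ler_wpM2r//; exact: (opnormP AsAb).
have hAs y : `|As y| <= Num.sqrt L * `|y|.
  have [->|y0] := eqVneq (As y) 0; first by rewrite normr0 mulr_ge0 ?sqrtr_ge0.
  have yp : 0 < `|As y| by rewrite normr_gt0.
  rewrite -(ler_pM2l yp) -expr2 -inner_norm -adjE.
  apply: le_trans (inner_le _ _) _.
  by rewrite mulrCA mulrA ler_wpM2r.
apply: opnorm_le => //; first exact: normal_op_bounded.
move=> y; rewrite -{1}(sqr_sqrtr L0) expr2 -mulrA.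
by rewrite (le_trans (hA _))// ler_wpM2l// sqrtr_ge0.
Qed.

Lemma normal_op_approx_point_spectrum t : approx_point_spectrum B t ->
  0 <= t /\ t <= opnorm (As \o A).
Proof.
move=> tB; split; first exact: approx_point_spectrum_ge0 normal_op_ge0 tB.
apply: le_trans opnorm_normal_op_le; apply: le_trans (ler_norm _) _.
exact: approx_point_spectrum_le_opnorm normal_op_bounded tB.
Qed.

Variable y : Y.
Let yd := ydagger A y.

Lemma ydagger_spec : closure (range A) yd /\
  forall v, closure (range A) v -> inner (y - yd) v = 0.
Proof.
have RL (a : R) u v : range A u -> range A v -> range A (a *: u + v).
  by move=> [u' _ <-] [v' _ <-]; exists (a *: u' + v') => //; rewrite linearP.
apply: orth_proj_subspace.
- by apply: subset_closure; exists 0 => //; rewrite linear0.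
- exact: closure_linear RL.
- exact: closed_closure.
Qed.

(** [y - yd] is orthogonal to the range of [A], so [yd] may replace [y] in the
    Landweber step. *)
Lemma adjoint_ydagger : As (y - yd) = 0.
Proof.
apply: inner_eq_all => u; rewrite -adjE inner0r innerC.
by apply: ydagger_spec.2; apply: subset_closure; exists u.
Qed.

(** Pythagoras, as [A x - yd] lies in the closure of the range of [A] and
    [y - yd] is orthogonal to it. *)
Lemma least_squaresE x : least_squares A y x =
  2^-1 * `|A x - yd| ^+ 2 + 2^-1 * `|y - yd| ^+ 2.
Proof.
rewrite /least_squares -mulrDr; congr (_ * _).
have -> : A x - y = (A x - yd) - (y - yd) by rewrite opprB addrA subrK.
have [ydR orth] := ydagger_spec.
rewrite [LHS]sqr_normB (innerC (A x - yd)) innerBr !orth ?subrr ?mulr0 ?subr0//.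
by apply: subset_closure; exists x.
Qed.

Lemma least_squares_gap x :
  0 <= least_squares A y x - inf (range (least_squares A y))
    <= 2^-1 * `|A x - yd| ^+ 2.
Proof.
have lb : lbound (range (least_squares A y)) (2^-1 * `|y - yd| ^+ 2).
  by move=> _ [z _ <-]; rewrite least_squaresE lerDr mulr_ge0 ?sqr_ge0.
apply/andP; split.
  by rewrite subr_ge0; apply: ge_inf; [eexists; exact: lb | exists x].
rewrite lerBlDr least_squaresE lerD2l; apply: lb_le_inf => //.
by exists (least_squares A y 0); exists 0.
Qed.

Lemma argmin_least_squares l : A l = yd ->
  argmin (least_squares A y) = [set x | A x = yd].
Proof.
move=> Al; apply/seteqP; split => x /=.
  move=> /(_ l); rewrite !least_squaresE Al subrr normr0 expr0n mulr0 add0r.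
  rewrite gerDr pmulr_rle0 ?invr_gt0// => h.
  by apply/eqP; rewrite -subr_eq0 -normr_eq0 -sqrf_eq0 eq_le h sqr_ge0.
move=> Ax z; rewrite !least_squaresE Ax subrr normr0 expr0n mulr0 add0r.
by rewrite lerDr mulr_ge0 ?sqr_ge0.
Qed.

(** The set of minimizers is [l] plus the kernel of [A]. *)
Lemma orth_proj_argmin x0 l : A l = yd ->
  (forall v, A v = 0 -> inner (x0 - l) v = 0) ->
  orth_proj (argmin (least_squares A y)) x0 = l.
Proof.
move=> Al orth; rewrite (argmin_least_squares Al).
by apply: orth_proj_eq => // c /= Ac; apply: orth; rewrite linearB Ac Al subrr.
Qed.

Variables (lambda : R) (x : nat -> X).
Hypothesis lambda_gt0 : 0 < lambda.
Hypothesis lambda_lt : lambda < 2 * (opnorm (As \o A))^-1.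
Hypothesis landweber : forall n, x n.+1 = x n - lambda *: As (A (x n) - y).

Let L := opnorm (As \o A).
Let P : {poly R} := 1 - lambda *: 'X.

Let L_gt0 : 0 < L.
Proof.
have := lt_trans lambda_gt0 lambda_lt; rewrite pmulr_rgt0// invr_gt0.
exact.
Qed.

Let lambdaL : lambda * L < 2.
Proof. by move: lambda_lt; rewrite ltr_pdivlMr. Qed.

Lemma landweber_residual n : x n.+1 = x n - lambda *: As (A (x n) - yd).
Proof.
rewrite landweber; congr (_ - _ *: _).
have -> : A (x n) - y = (A (x n) - yd) - (y - yd) by rewrite opprB addrA subrK.
by rewrite [LHS]linearB adjoint_ydagger subr0.
Qed.

Lemma residualE n : A (x n) - yd = poly_op (P ^+ n) B (A (x 0%N) - yd).
Proof.
elim: n => [|n IH]; first by rewrite expr0 poly_op1.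
rewrite exprS poly_opM -IH /P poly_opB poly_op1 poly_opZ poly_opX.
by rewrite landweber_residual linearB linearZ/= addrAC.
Qed.

Let Q m k : {poly R} := lambda *: \sum_(j < k) P ^+ (m + j).

Let QS m k : Q m k.+1 = Q m k + lambda *: P ^+ (m + k).
Proof. by rewrite /Q big_ord_recr/= scalerDr. Qed.

Let Q0 m : Q m 0 = 0.
Proof. by rewrite /Q big_ord0 scaler0. Qed.

Lemma landweber_increment m k :
  x (m + k)%N = x m - As (poly_op (Q m k) B (A (x 0%N) - yd)).
Proof.
elim: k => [|k IH].
  by rewrite Q0 poly_op0 linear0 subr0 addn0.
rewrite addnS landweber_residual {1}IH (residualE (m + k)) QS.
have AsP a u v : As (u + a *: v) = As u + a *: As v by rewrite linearD linearZ.
by rewrite poly_opD poly_opZ AsP opprD addrA.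
Qed.

(** A telescoping geometric sum.  The factor [X] is what [A] and [A*] contribute
    to the squared norm of an increment. *)
Lemma increment_polyE m k : 'X * Q m k = P ^+ m - P ^+ (m + k).
Proof.
elim: k => [|k IH].
  by rewrite Q0 mulr0 addn0 subrr.
have mulP W : W * P = W - lambda *: (W * 'X).
  by rewrite /P mulrBr mulr1 -scalerAr.
rewrite QS mulrDr IH addnS exprSr mulP -scalerAr (mulrC 'X).
by rewrite opprB [RHS]addrA [RHS]addrAC.
Qed.

Variables (nu : R) (w : Y).
Hypothesis nu_gt0 : 0 < nu.
Let S := op_powR (A \o As) nu.
Hypothesis source : A (x 0%N) - yd = S w.

Let inner_S (m : {poly R}) (c : R) : 0 <= c ->
  (forall t, 0 <= t -> t <= L -> `|m.[t]| * (t `^ nu) ^+ 2 <= c) ->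
  inner (poly_op m B (S w)) (S w) <= c * `|w| ^+ 2.
Proof.
move=> c0 hc; apply: (inner_fun_calc_le normal_op_bounded normal_op_sym) => //.
by move=> t /normal_op_approx_point_spectrum[t0 tL]; exact: hc.
Qed.

Let hornerP n t : (P ^+ n).[t] = (1 - lambda * t) ^+ n.
Proof. by rewrite horner_exp /P !hornerE. Qed.

(** The squared norm is [<(1 - lambda B)^(2n) S w, S w>].  The constant uses
    [|w| + 1] only so as to be positive when [w = 0]. *)
Lemma residual_rate : exists2 C, 0 < C & forall n, (0 < n)%N ->
  `|A (x n) - yd| <= C * n%:R `^ (- nu).
Proof.
have [C C0 hC] := landweber_filter_le lambda_gt0 L_gt0 lambdaL nu_gt0.
exists (C * (`|w| + 1)); first by rewrite mulr_gt0// ltr_pwDr.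
move=> n n0.
have : `|A (x n) - yd| <= C * n%:R `^ (- nu) * `|w|.
  have c0 : 0 <= C * n%:R `^ (- nu) by rewrite mulr_ge0 ?powR_ge0// ltW.
  rewrite -ler_sqr ?nnegrE ?(mulr_ge0 c0)// exprMn residualE source.
  rewrite -inner_norm -(poly_op_sym normal_op_sym) -poly_opM.
  apply: inner_S => [|t t0 tL]; first exact: sqr_ge0.
  rewrite hornerM normrM hornerP normrX -expr2 -exprMn.
  have l0 : 0 <= `|1 - lambda * t| ^+ n * t `^ nu.
    by rewrite mulr_ge0 ?powR_ge0 ?exprn_ge0.
  by rewrite ler_sqr ?nnegrE//; exact: hC.
move=> h; apply: le_trans h _; rewrite mulrAC ler_wpM2r ?powR_ge0//.
by rewrite ler_wpM2l ?(ltW C0)// lerDl.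
Qed.

Variable mu : R.
Hypothesis mu_gt0 : 0 < mu.
Hypothesis nuE : nu = mu + 2^-1.

Let sqr_powR_nu t : 0 <= t -> (t `^ nu) ^+ 2 = t * (t `^ mu) ^+ 2.
Proof.
move=> t0; rewrite !expr2 -powRD; last first.
  by apply/implyP; rewrite gt_eqF// addr_gt0.
have -> : nu + nu = 1 + (mu + mu) by rewrite nuE; field.
rewrite powRD; last by apply/implyP; rewrite gt_eqF// !addr_gt0.
by rewrite powRr1// powRD//; apply/implyP; rewrite gt_eqF// addr_gt0.
Qed.

(** The squared norm is [<B g(B)^2 S w, S w>] with [g] the polynomial [Q m k].
    On the spectrum, [t g(t)^2 t^(2 nu) = (t g(t) t^mu)^2], where [t g(t)] is a
    difference of two powers of [1 - lambda t], at most
    [2 |1 - lambda t|^m] in absolute value. *)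
Lemma increment_rate : exists2 K, 0 < K & forall m k, (0 < m)%N ->
  `|x (m + k)%N - x m| <= K * m%:R `^ (- mu).
Proof.
have [C C0 hC] := landweber_filter_le lambda_gt0 L_gt0 lambdaL mu_gt0.
exists (2 * C * (`|w| + 1)); first by rewrite !mulr_gt0// ltr_pwDr.
move=> m k m0; set r := m%:R `^ (- mu).
have r0 : 0 <= r by exact: powR_ge0.
have h : `|x (m + k)%N - x m| <= 2 * C * r * `|w|.
  have c0 : 0 <= 2 * C * r by rewrite !mulr_ge0// ltW.
  rewrite -ler_sqr ?nnegrE ?(mulr_ge0 c0)// exprMn.
  rewrite landweber_increment addrAC subrr add0r normrN -inner_norm -adjE.
  rewrite -[A (As _)]/(B _) -poly_opXM source.
  rewrite -(poly_op_sym normal_op_sym) -poly_opM.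
  apply: inner_S => [|t t0 tL]; first exact: sqr_ge0.
  have -> : `|(Q m k * ('X * Q m k)).[t]| * (t `^ nu) ^+ 2
      = (`|('X * Q m k).[t]| * t `^ mu) ^+ 2.
    rewrite sqr_powR_nu// !hornerM hornerX !normrM (ger0_norm t0).
    by ring.
  have l0 : 0 <= `|('X * Q m k).[t]| * t `^ mu by rewrite mulr_ge0 ?powR_ge0.
  rewrite ler_sqr ?nnegrE// -mulrA.
  apply: (@le_trans _ _ (2 * (`|1 - lambda * t| ^+ m * t `^ mu))); last first.
    by rewrite ler_pM2l//; exact: hC.
  rewrite mulrA ler_wpM2r ?powR_ge0// increment_polyE hornerD hornerN !hornerP.
  rewrite (le_trans (ler_normB _ _))// mulr_natl mulr2n !normrX lerD2l.
  rewrite exprD ler_piMr ?exprn_ge0// exprn_ile1//.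
  have lt0 : 0 <= lambda * t by rewrite mulr_ge0// ltW.
  have lt2 : lambda * t <= lambda * L by rewrite ler_pM2l.
  by rewrite ler_norml; apply/andP; split; move: lambdaL; lra.
apply: le_trans h _; rewrite mulrAC ler_wpM2r//.
by rewrite ler_wpM2l ?mulr_ge0 ?(ltW C0)// lerDl.
Qed.

(** The limit of the iterates: the increments give the rate, the residuals give
    [A l = yd], and orthogonality of [x0 - l] to the kernel of [A] passes to the
    limit from [x0 - x_n], which lies in the range of [A*]. *)
Lemma landweber_cvg_rate : exists l,
  [/\ A l = yd, forall v, A v = 0 -> inner (x 0%N - l) v = 0
    & exists2 K, 0 < K & forall n, (0 < n)%N -> `|x n - l| <= K * n%:R `^ (- mu)].
Proof.
have [K K0 hK] := increment_rate.
(* Shifted by one because [0 `^ (- mu)] is [0], which bounds no distance. *)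
have e0 : (fun n : nat => K * n.+1%:R `^ (- mu)) @ \oo --> (0 : R).
  rewrite -[X in _ --> X](mulr0 K); apply: cvgM; first exact: cvg_cst.
  exact: powRN_cvg0.
have ue m n : (m <= n)%N -> `|x n.+1 - x m.+1| <= K * m.+1%:R `^ (- mu).
  by move=> mn; rewrite -(subnKC mn) -addSn; exact: hK.
have [l hl] := cauchy_rate_cvg (u := fun n => x n.+1) ue e0.
have xl : (fun n => x n.+1) @ \oo --> l by exact: cvg_norm_bound hl e0.
exists l; split.
- have [C C0 hC] := residual_rate.
  have Al : (fun n => A (x n.+1)) @ \oo --> A l by exact: bounded_op_cvg xl.
  have Ay : (fun n => A (x n.+1)) @ \oo --> yd.
    apply: (@cvg_norm_bound _ _ _ _ (fun n : nat => C * n.+1%:R `^ (- nu))).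
      by move=> n; rewrite distrC; exact: hC.
    rewrite -[X in _ --> X](mulr0 C); apply: cvgM; first exact: cvg_cst.
    exact: powRN_cvg0.
  exact: cvg_unique Al Ay.
- move=> v Av.
  have h n : inner (x 0%N - x n) v = 0.
    elim: n => [|n IH]; first by rewrite subrr inner0l.
    rewrite landweber_residual opprB addrCA innerDl IH addr0 innerZl innerC.
    by rewrite -adjE Av inner0l mulr0.
  have h1 : (fun n => inner (x 0%N - x n.+1) v) @ \oo --> inner (x 0%N - l) v.
    apply: cvg_inner; last exact: cvg_cst.
    by apply: cvgB => //; exact: cvg_cst.
  have h2 : (fun n => inner (x 0%N - x n.+1) v) @ \oo --> (0 : R).
    by under eq_fun do rewrite h; exact: cvg_cst.
  exact: cvg_unique h1 h2.
- by exists K => // -[//|n] _; rewrite distrC; exact: hl.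
Qed.

End Landweber.

Theorem corollary5p12 (R : realType) (X Y : hilbertType R)
  (A : {linear X -> Y}) (A_bounded : bounded_op A)
  (A_neq0 : exists v : X, A v != 0)
  (y : Y) (lambda : R)
  (lambda_gt0 : 0 < lambda)
  (lambda_lt : lambda < 2 * (opnorm (adjoint A \o A))^-1)
  (x : nat -> X)
  (landweber : forall n : nat,
     x n.+1 = x n - lambda *: adjoint A (A (x n) - y))
  (mu : R) (mu_gt : - 2^-1 < mu)
  (source : Xspace A y mu (x 0%N)) :
  let f := least_squares A y in
  ((fun n : nat => f (x n) - inf (range f))
     =O_\oo (fun n : nat => n%:R `^ (- (1 + 2 * mu)))) /\
  (0 < mu ->
   (fun n : nat => `|x n - orth_proj (argmin f) (x 0%N)|)
     =O_\oo (fun n : nat => n%:R `^ (- mu))).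
Proof.
move=> f.
have nu0 : 0 < mu + 2^-1 by lra.
have adjE := adjointE A_bounded.
have [As AsE] := linear_ex (adjoint_linear A_bounded).
rewrite AsE in adjE lambda_lt landweber.
have [w Sw] : exists w, A (x 0%N) - ydagger A y
    = op_powR (A \o As) (mu + 2^-1) w.
  rewrite -AsE; move: source => [_ [w _ <-] <-]; exists w.
  by rewrite addrAC subrr add0r.
split=> [|mu0].
  have [C C0 hC] := residual_rate A_bounded adjE lambda_gt0 lambda_lt
    landweber nu0 Sw.
  apply/eqO_exP; exists (2^-1 * C ^+ 2); first by rewrite mulr_gt0// exprn_gt0.
  exists 1%N => // n /= n0.
  have /andP[g0 g1] := least_squares_gap A y (x n).
  rewrite ger0_norm// ger0_norm ?powR_ge0//; apply: le_trans g1 _.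
  rewrite -mulrA ler_pM2l//.
  have nR : n%:R != 0 :> R by rewrite pnatr_eq0 -lt0n.
  have -> : - (1 + 2 * mu) = - (mu + 2^-1) + - (mu + 2^-1) by field.
  rewrite powRD ?nR ?implybT// -expr2 -exprMn.
  have c0 : 0 <= C * n%:R `^ (- (mu + 2^-1)) by rewrite mulr_ge0 ?powR_ge0 ?ltW.
  by rewrite ler_sqr ?nnegrE//; exact: hC.
have [l [Al orth [K K0 hK]]] := landweber_cvg_rate A_bounded adjE lambda_gt0
  lambda_lt landweber nu0 Sw mu0 erefl.
have -> : orth_proj (argmin f) (x 0%N) = l by exact: orth_proj_argmin.
apply/eqO_exP; exists K => //; exists 1%N => // n /= n0.
by rewrite normr_id [leRHS]mulrC ger0_norm ?powR_ge0// mulrC; exact: hK.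
Qed.
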